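(* Let $\lambda\in\mathbb{R}$, let $Y$ be a random variable whose moment generating function exists in a neighborhood of the origin, and let $x\in[0,1]$. For all integers $n\ge k\ge 0$, \[ (x)_{k,\lambda}\sum_{j=0}^{n}\binom{1-x}{j}j!\,{n\brace j}_{Y,\lambda}=\frac{B_{k,n+k}^{Y}(x|\lambda)}{\binom{n+k}{k}}. \]
   Context: For $\lambda\in\mathbb{R}$, $(x)_{0,\lambda}=1$, $(x)_{n,\lambda}=x(x-\lambda)\cdots(x-(n-1)\lambda)$ for $n\ge1$, and $e_\lambda^x(t)=\sum_{n\ge0}(x)_{n,\lambda}\frac{t^n}{n!}$. For the random variable $Y$, $E[e_\lambda^Y(t)]$ denotes the power series $\sum_{n\ge0}E[(Y)_{n,\lambda}]\frac{t^n}{n!}$ (constant term $1$); for real $a$, $(E[e_\lambda^Y(t)])^a=\sum_{j\ge0}\binom{a}{j}(E[e_\lambda^Y(t)]-1)^j$. The probabilistic degenerate Stirling numbers of the second kind: $\frac{1}{k!}(E[e_\lambda^Y(t)]-1)^k=\sum_{n\ge k}{n\brace k}_{Y,\lambda}\frac{t^n}{n!}$. The probabilistic degenerate Bernstein polynomials: $\frac{1}{k!}(x)_{k,\lambda}t^k(E[e_\lambda^Y(t)])^{1-x}=\sum_{n\ge k}B_{k,n}^{Y}(x|\lambda)\frac{t^n}{n!}$. *)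

(* Defs.v *)
From HB Require Import structures.
From mathcomp Require Export all_boot all_order all_algebra.
From mathcomp Require Export all_classical all_reals all_analysis.

Set Implicit Arguments.
Unset Strict Implicit.
Unset Printing Implicit Defensive.

Export Order.TTheory GRing.Theory Num.Theory.
Export numFieldNormedType.Exports.

Local Open Scope ring_scope.

(* A formal power series is given by its ordinary coefficients: f n = [t^n] f.
   The ring operations below are kept apart from the pointwise operations that
   MathComp puts on functions nat -> R. *)
Definition fps (R : realType) := nat -> R.

Definition fps_one (R : realType) : fps R := fun n => (n == 0%N)%:R.

Definition fps_X (R : realType) : fps R := fun n => (n == 1%N)%:R.

Definition fps_sub (R : realType) (f g : fps R) : fps R := fun n => f n - g n.

Definition fps_scale (R : realType) (c : R) (f : fps R) : fps R :=
  fun n => c * f n.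

Definition fps_mul (R : realType) (f g : fps R) : fps R :=
  fun n => \sum_(i < n.+1) f i * g (n - i)%N.

Definition fps_pow (R : realType) (f : fps R) (k : nat) : fps R :=
  iter k (fps_mul f) (fps_one R).

(* n! [t^n] f, i.e. the a_n such that f = sum_n a_n t^n / n! *)
Definition egf_coef (R : realType) (f : fps R) (n : nat) : R :=
  n`!%:R * f n.

(* (x)_{n,lambda} = x (x - lambda) ... (x - (n-1) lambda) *)
Definition dfall (R : realType) (lambda x : R) (n : nat) : R :=
  \prod_(i < n) (x - i%:R * lambda).

Definition gbinom (R : realType) (a : R) (j : nat) : R :=
  dfall 1 a j / j`!%:R.

(* f^a = sum_(j >= 0) binom(a, j) (f - 1)^j, the infinite sum being taken
   coefficientwise; when f 0 = 1 the t^n coefficient of (f - 1)^j vanishes for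
   j > n, so that each of these real series has finitely many nonzero terms. *)
Definition fps_rpow (R : realType) (f : fps R) (a : R) : fps R :=
  fun n => limn (fun N : nat =>
    \sum_(0 <= j < N) gbinom a j * fps_pow (fps_sub f (fps_one R)) j n).

Section ProbabilisticDegenerate.
Context (d : measure_display) (T : measurableType d) (R : realType).
Context (P : probability T R) (Y : {RV P >-> R}) (lambda : R).

(* The moment generating function takes values in [0, +oo]. *)
Definition mgf_exists_near0 : Prop :=
  \forall t \near (0 : R), ('M_P Y t < +oo)%E.

(* E[e_lambda^Y(t)] = sum_n E[(Y)_{n,lambda}] t^n / n! *)
Definition Edegexp : fps R :=
  fun n => fine 'E_P[fun w => dfall lambda (Y w) n] / n`!%:R.

Definition pdStirling2 (n k : nat) : R :=
  egf_coef
    (fps_scale (k`!%:R)^-1 (fps_pow (fps_sub Edegexp (fps_one R)) k)) n.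

Definition pdBernstein (k n : nat) (x : R) : R :=
  egf_coef
    (fps_scale ((k`!%:R)^-1 * dfall lambda x k)
      (fps_mul (fps_pow (fps_X R) k) (fps_rpow Edegexp (1 - x)))) n.

End ProbabilisticDegenerate.

(* Main.v *)
(* The constant term of E[e_lambda^Y(t)] - 1 vanishes, so the binomial series of
   E[e_lambda^Y(t)]^(1-x) has only the terms j <= n in its t^n coefficient; the
   factor t^k of the Bernstein generating function only shifts the index, and
   (n+k)! / k! = binom(n+k, k) n! accounts for the normalisation. *)
Require Import Defs.

Local Open Scope ring_scope.

Lemma fps_mulXS (R : realType) (f : fps R) (n : nat) :
  fps_mul (fps_X R) f n.+1 = f n.
Proof.
rewrite /fps_mul !big_ord_recl /= /fps_X /= mul0r add0r mul1r.
by rewrite big1 ?addr0 ?subn1// => i _; rewrite mul0r.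
Qed.

Lemma fps_mulX0 (R : realType) (f : fps R) : fps_mul (fps_X R) f 0%N = 0.
Proof. by rewrite /fps_mul big_ord1 /fps_X mul0r. Qed.

Lemma fps_XnE (R : realType) (k n : nat) :
  fps_pow (fps_X R) k n = (n == k)%:R.
Proof.
elim: k n => [//|k IHk] [|n]; rewrite /fps_pow iterS ?fps_mulX0 ?fps_mulXS//.
by rewrite -/(fps_pow _ _) IHk.
Qed.

(** The convolution has a single nonzero term, at index [k], which is in range even for [n = 0]. *)
Lemma fps_mulXn (R : realType) (f : fps R) (k n : nat) :
  fps_mul (fps_pow (fps_X R) k) f (n + k)%N = f n.
Proof.
have lt_k : (k < (n + k).+1)%N by rewrite ltnS leq_addl.
rewrite /fps_mul (bigD1 (Ordinal lt_k)) //= fps_XnE eqxx mul1r addnK.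
rewrite big1 ?addr0// => i; rewrite -val_eqE /= => /negPf neq_ik.
by rewrite fps_XnE neq_ik mul0r.
Qed.

(** Each factor without constant term raises the order of vanishing at the origin by at least
    one. *)
Lemma fps_pow_coef0 (R : realType) (f : fps R) (j n : nat) :
  f 0%N = 0 -> (n < j)%N -> fps_pow f j n = 0.
Proof.
move=> f0; elim: j n => [//|j IHj] n lt_nj.
rewrite /fps_pow iterS -/(fps_pow f j) /fps_mul big_ord_recl /= f0 mul0r add0r.
rewrite big1// => i _; rewrite IHj ?mulr0//.
(* For [n = 0] the remaining index set is empty. Otherwise [f] contributes a degree at least 1, so
   [fps_pow f j] is read at a degree below [j]. *)
have := ltn_ord i; case: n lt_nj i => [|n] lt_nj i lt_in //.
by rewrite /bump /= add1n subSS (leq_ltn_trans (leq_subr _ _)).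
Qed.

Lemma fps_rpowE (R : realType) (f : fps R) (a : R) (n : nat) :
  f 0%N = 1 ->
  fps_rpow f a n =
    \sum_(0 <= j < n.+1) gbinom a j * fps_pow (fps_sub f (fps_one R)) j n.
Proof.
(* The partial sums are constant from [N = n.+1] on, so the limit is that constant. *)
move=> f0; apply: lim_near_cst => //.
near=> N.
have le_nN : (n.+1 <= N)%N by near: N; exact: nbhs_infty_ge.
rewrite (big_cat_nat (leq0n n.+1) le_nN) //= [X in _ + X]big_nat [X in _ + X]big1 ?addr0//.
move=> j /andP[lt_nj _].
by rewrite fps_pow_coef0 ?mulr0// /fps_sub f0 /fps_one eqxx subrr.
Unshelve. all: by end_near. Qed.

(** An empty product is 1 and [P] has total mass 1. This allows [fps_rpowE] to be applied to
    [Edegexp]. *)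
Lemma Edegexp0 (d : measure_display) (T : measurableType d) (R : realType)
    (P : probability T R) (Y : {RV P >-> R}) (lambda : R) :
  Edegexp Y lambda 0%N = 1.
Proof.
rewrite /Edegexp fact0 divr1.
have -> : (fun w => dfall lambda (Y w) 0) = cst 1.
  by apply/funext => w; rewrite /dfall big_ord0.
by rewrite expectation_cst.
Qed.

Theorem theorem2p3 (d : measure_display) (T : measurableType d) (R : realType)
    (P : probability T R) (Y : {RV P >-> R}) (lambda x : R) (n k : nat)
    (hY : mgf_exists_near0 Y) (hx : 0 <= x <= 1) (hkn : (k <= n)%N) :
  dfall lambda x k *
    \sum_(0 <= j < n.+1) gbinom (1 - x) j * j`!%:R * pdStirling2 Y lambda n j
  = pdBernstein Y lambda k (n + k) x / 'C(n + k, k)%:R.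
Proof.
have fact_neq0 m : m`!%:R != 0 :> R by rewrite pnatr_eq0 -lt0n fact_gt0.
have bin_neq0 : 'C(n + k, k)%:R != 0 :> R.
  by rewrite pnatr_eq0 -lt0n bin_gt0 leq_addl.
have factE : (n + k)`!%:R = 'C(n + k, k)%:R * (k`!%:R * n`!%:R) :> R.
  by rewrite -!natrM -(bin_fact (leq_addl n k)) addnK.
rewrite /pdBernstein /egf_coef /fps_scale fps_mulXn fps_rpowE ?Edegexp0//.
(* [S] is the coefficient of [t^n] in the real power with exponent [1 - x]. *)
set S := (X in _ = _ * (_ * X) / _).
(* Termwise, [j!] cancels the [1/j!] in the Stirling generating function, leaving the common factor
   [n!]. *)
have -> : \sum_(0 <= j < n.+1)
    gbinom (1 - x) j * j`!%:R * pdStirling2 Y lambda n j = n`!%:R * S.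
  rewrite /S mulr_sumr; apply: eq_bigr => j _.
  rewrite /pdStirling2 /egf_coef /fps_scale.
  by rewrite [n`!%:R * (_ * _)]mulrCA -mulrA mulVKf// mulrCA.
rewrite factE -['C(_, _)%:R * _ * _]mulrA [RHS]mulrC mulKf//.
by rewrite [k`!%:R * _]mulrC -!mulrA mulVKf// mulrCA.
Qed.
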